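(* Let $\Omega=[0,1]$ and let $\nu$ be the uniform (Lebesgue) measure on $[0,1]$. Let $\{\Sigma'_n\}_{n\ge1}$ be a sequence of solutions to the short-term optimal location problem, $s_n:=F(\Sigma'_n)$, and let $l_n$ be the optimal cost of the long-term optimal location problem. Then \[ 1<\liminf_{n\to\infty} \frac{s_n}{l_n}<\limsup_{n\to\infty}\frac{s_n}{l_n}. \]
   Context: For a finite nonempty set $\Sigma\subset[0,1]$ put $F(\Sigma):=\int_0^1 \mathrm{dist}(x,\Sigma)\,dx$. The long-term optimal location problem is to minimize $F(\Sigma)$ over all nonempty $\Sigma\subset[0,1]$ with $\#\Sigma\le n$; its minimum value is $l_n$. A sequence of solutions to the short-term optimal location problem is a sequence $\{\Sigma'_n\}_{n\ge1}$ such that, with $\Sigma'_0:=\emptyset$, for each $n\ge1$ the set $\Sigma'_n$ minimizes $F$ among all nonempty sets $\Sigma$ with $\Sigma'_{n-1}\subset\Sigma\subset[0,1]$ and $\#\Sigma\le n$. *)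

(* Defs.v *)
From HB Require Import structures.
From mathcomp Require Import all_boot all_order all_algebra finmap.
From mathcomp Require Import all_classical all_reals all_analysis.

Set Implicit Arguments.
Unset Strict Implicit.
Unset Printing Implicit Defensive.

Import Order.TTheory GRing.Theory Num.Theory.
Import numFieldNormedType.Exports.

Local Open Scope classical_set_scope.
Local Open Scope ring_scope.

(* [inf set0 = 0], so [dist] is the usual distance only for [A !=set0]. *)
Definition dist (R : realType) (x : R) (A : set R) : R :=
  inf [set `|x - a| | a in A].

Definition location_cost (R : realType) (S : {fset R}) : R :=
  \int[lebesgue_measure]_(x in `[0, 1]) dist x [set` S].

Definition admissible (R : realType) (n : nat) (S : {fset R}) : Prop :=
  [/\ S != fset0, {subset S <= `[0, 1]} & (#|` S| <= n)%N].

Definition minimizer (R : realType) (P : {fset R} -> Prop) (S : {fset R}) :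
    Prop :=
  P S /\ forall T : {fset R}, P T -> location_cost S <= location_cost T.

(* The infimum is attained for [0 < n]; for [n = 0] there is no admissible set
   and the value is the junk [inf set0 = 0]. *)
Definition long_term_cost (R : realType) (n : nat) : R :=
  inf [set location_cost S | S in admissible n].

Definition short_term_solution (R : realType) (Sigma : nat -> {fset R}) :
    Prop :=
  Sigma 0%N = fset0 /\
  forall n : nat,
    minimizer (fun S => admissible n.+1 S /\ (Sigma n `<=` S)%fset)
      (Sigma n.+1).

(* Main.v *)
(* Sorting the points of S cuts [0, 1] into two end pieces, of cost L^2/2, and
   interior pieces, of cost L^2/4.  By convexity the optimal cost with n points
   is 1/(4n).  The best cut of an end piece is at a third of its length (gain
   L^2/3), that of an interior piece is at its midpoint (gain L^2/8); each step
   of a short-term solution performs a best cut with the largest gain.  Starting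
   from {1/2}, all interior pieces thus have length 3^-k 2^-j, and the total
   length produced in each class k is fixed.

   Cauchy-Schwarz is nearly sharp only if most pieces have length close to 1/n;
   but the classes k = 1 and k = 2 cannot both do so, since 2^i/3 stays away
   from 1.  Hence the lower limit of 4 n s_n exceeds 1.

   All the interior pieces of length 1/(3 2^j) are bisected during consecutive
   steps with the same gain.  There are 2^(j+1) of them, so s_n is affine and
   n s_n is quadratic on a block on which its second difference has a fixed
   nonzero value.  As n s_n is bounded, it does not converge. *)

Require Import Defs.
From HB Require Import structures.
From mathcomp Require Import all_boot all_order all_algebra finmap.
From mathcomp Require Import all_classical all_reals all_analysis.
From mathcomp Require Import ring lra.

Set Implicit Arguments.
Unset Strict Implicit.
Unset Printing Implicit Defensive.

Import Order.TTheory GRing.Theory Num.Theory.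
Import numFieldNormedType.Exports.

Local Open Scope classical_set_scope.
Local Open Scope ring_scope.

(** * The cost of a sorted list of points *)

Section DistanceIntegral.
Context {R : realType}.
Implicit Types (a b x : R) (l : seq R).

Lemma dist_set1 x a : dist x [set` [:: a]] = `|x - a|.
Proof.
rewrite /dist (_ : [set` [:: a]] = [set a]) ?image_set1 ?inf1//.
by apply/seteqP; split => y /=; rewrite inE => /eqP.
Qed.

Lemma dist_cons x a b l :
  dist x [set` a :: b :: l] = Num.min `|x - a| (dist x [set` b :: l]).
Proof.
have lbE (A : set R) : lbound [set `|x - y| | y in A] 0 by move=> _ [y _ <-].
have hE (A : set R) : has_lbound [set `|x - y| | y in A] by exists 0.
have leE c (s : seq R) : c \in s -> dist x [set` s] <= `|x - c|.
  by move=> cs; apply: ge_inf => //; exists c.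
apply/eqP; rewrite eq_le le_min ge_min; apply/andP; split.
  rewrite leE ?mem_head//=; apply: lb_le_inf.
    by exists `|x - b|, b => //=; rewrite mem_head.
  by move=> _ [c /= cl <-]; apply: leE; rewrite inE cl orbT.
suff: Num.min `|x - a| (dist x [set` b :: l]) <= dist x [set` a :: b :: l].
  by rewrite ge_min.
apply: lb_le_inf; first by exists `|x - a|, a => //=; rewrite mem_head.
move=> y [c /=]; rewrite inE => /predU1P[->|cl] <-; rewrite ge_min ?lexx//.
by rewrite leE ?orbT.
Qed.

Lemma dist_le_head x a l : dist x [set` a :: l] <= `|x - a|.
Proof.
by case: l => [|b l]; rewrite ?dist_set1// dist_cons ge_min lexx.
Qed.

Lemma dist_left x a l :
  path <%R a l -> x <= a -> dist x [set` a :: l] = a - x.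
Proof.
elim: l a => [|b l IH] a /=.
  by move=> _ xa; rewrite dist_set1 distrC ger0_norm ?subr_ge0.
move=> /andP[ab bl] xa; rewrite dist_cons IH//; last first.
  by lra.
by rewrite ler0_norm ?min_l; lra.
Qed.

Lemma dist_between x a b l : path <%R b l -> a <= x <= b ->
  dist x [set` a :: b :: l] = Num.min (x - a) (b - x).
Proof.
by move=> bl /andP[ax xb]; rewrite dist_cons dist_left// ger0_norm//; lra.
Qed.

Lemma dist_right x a b l : a < b -> b <= x ->
  dist x [set` a :: b :: l] = dist x [set` b :: l].
Proof.
move=> ab bx; rewrite dist_cons min_r// (le_trans (dist_le_head _ _ _))//.
by rewrite !ger0_norm; lra.
Qed.

Lemma continuous_dist a l :
  continuous (fun x : R => dist x [set` a :: l] : R^o).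
Proof.
have nrm c : continuous (fun x : R => `|x - c| : R^o).
  move=> x; apply: (@continuous_comp _ _ _ (fun y : R => y - c) Num.norm).
    by apply: cvgB; [exact: cvg_id|exact: cvg_cst].
  exact: norm_continuous.
elim: l a => [|b l IH] a x.
  by under eq_fun do rewrite dist_set1; exact: nrm.
rewrite (_ : (fun y : R => dist y [set` a :: b :: l]) =
    (fun y : R => `|y - a| : R^o) \min
    (fun y : R => dist y [set` b :: l] : R^o)).
  by apply: continuous_min; [exact: nrm|exact: IH].
by apply/funext => y; exact: dist_cons.
Qed.

Lemma integrable_continuous_itv (f : R -> R) a b : continuous (f : R -> R^o) ->
  lebesgue_measure.-integrable `[a, b] (EFin \o f).
Proof.
move=> cf; apply: continuous_compact_integrable; first exact: segment_compact.
exact: continuous_subspaceT.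
Qed.

Lemma Rintegral_itv_split (f : R -> R) a b c : continuous (f : R -> R^o) ->
  a <= b <= c ->
  \int[lebesgue_measure]_(x in `[a, c]) f x =
  \int[lebesgue_measure]_(x in `[a, b]) f x +
  \int[lebesgue_measure]_(x in `[b, c]) f x.
Proof.
move=> cf /andP[ab bc].
have /(_ b) := Rintegral_itvB (integrable_continuous_itv a c cf).
rewrite !bnd_simp => /(_ ab bc) /eqP; rewrite subr_eq => /eqP ->.
rewrite addrC Rintegral_itv_obnd_cbnd//.
apply: integrableS (integrable_continuous_itv b c cf) => //.
exact: subset_itv_oc_cc.
Qed.

Lemma Rintegral_affine (u v a b : R) : a <= b ->
  \int[lebesgue_measure]_(x in `[a, b]) (u * x + v) =
  u * (b ^+ 2 - a ^+ 2) / 2 + v * (b - a).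
Proof.
rewrite le_eqVlt => /predU1P[<-|ab].
  by rewrite set_itv1 Rintegral_set1 !subrr !mulr0 mul0r addr0.
pose F (x : R) : R^o := u / 2 * x ^+ 2 + v * x.
have dF (x : R) : is_derive x 1 F (u * x + v).
  apply: is_derive_eq.
  by rewrite /GRing.scale /=; field.
have cF : continuous F.
  by move=> y; apply: differentiable_continuous;
     exact/derivable1_diffP/ex_derive.
rewrite /Rintegral (@continuous_FTC2 _ (fun x => u * x + v) F)//.
- by rewrite /= /F; field.
- apply: continuous_subspaceT => y; apply: cvgD; last exact: cvg_cst.
  by apply: cvgM; [exact: cvg_cst|exact: cvg_id].
- split => [y _| |].
  + exact: ex_derive.
  + exact/cvg_at_right_filter/cF.
  + exact/cvg_at_left_filter/cF.
- by move=> y _; rewrite derive1E; apply: derive_val.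
Qed.

Lemma eq_Rintegral_itv (f g : R -> R) a b :
  (forall x, a <= x <= b -> f x = g x) ->
  \int[lebesgue_measure]_(x in `[a, b]) f x =
  \int[lebesgue_measure]_(x in `[a, b]) g x.
Proof.
by move=> fg; apply: eq_Rintegral => x; rewrite inE/= in_itv/=; exact: fg.
Qed.

Lemma Rintegral_eq_affine (f : R -> R) (u v a b : R) : a <= b ->
  (forall x, a <= x <= b -> f x = u * x + v) ->
  \int[lebesgue_measure]_(x in `[a, b]) f x =
  u * (b ^+ 2 - a ^+ 2) / 2 + v * (b - a).
Proof. by move=> ab /eq_Rintegral_itv ->; exact: Rintegral_affine. Qed.

End DistanceIntegral.

Section Pieces.
Context {R : realType}.
Implicit Types (a b x t : R) (l s : seq R) (q : bool * R).

(* A piece is a component of the complement of the chosen points in [0, 1],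
   recorded as its length together with a flag that is set when one of its
   endpoints is 0 or 1, so that only the other one attracts mass. *)
Fixpoint gaps a l : seq (bool * R) :=
  if l is b :: l' then (false, b - a) :: gaps b l' else [:: (true, 1 - a)].

Definition pieces s : seq (bool * R) :=
  if s is a :: l then (true, a) :: gaps a l else [::].

Definition pcost q : R := q.2 ^+ 2 / (if q.1 then 2 else 4).

Definition gain q : R := q.2 ^+ 2 / (if q.1 then 3 else 8).

(** For an end piece, [t] is the length of the part next to 0 or 1; that part keeps the flag. *)
Definition split_piece q t := [:: (q.1, t); (false, q.2 - t)].

Definition best_cut q := q.2 / (if q.1 then 3 else 2).

Lemma Rintegral_dist_gaps a l :
  path <%R a l -> all (fun x => x <= 1) (a :: l) ->
  \int[lebesgue_measure]_(x in `[a, 1]) dist x [set` a :: l] =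
  \sum_(q <- gaps a l) pcost q.
Proof.
elim: l a => [|b l IH] a /=.
  move=> _; rewrite andbT => a1; rewrite big_seq1 /pcost /=.
  rewrite (Rintegral_eq_affine (u := 1) (v := - a))//; first by field.
  by move=> x /andP[ax _]; rewrite dist_set1 ger0_norm; lra.
move=> /andP[ab bl] /and3P[a1 b1 l1].
have cd := @continuous_dist R a (b :: l).
rewrite (Rintegral_itv_split (b := b) cd); last by rewrite (ltW ab).
rewrite [X in _ + X](@eq_Rintegral_itv _ _ (fun x => dist x [set` b :: l]));
    last by move=> x /andP[bx _]; exact: dist_right.
rewrite IH /=; [|done|by rewrite b1].
rewrite big_cons; congr (_ + _).
rewrite (Rintegral_itv_split (b := (a + b) / 2) cd); last by apply/andP; lra.
rewrite (Rintegral_eq_affine (u := 1) (v := - a)); last 2 first.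
- by lra.
- by move=> x /andP[? ?]; rewrite dist_between ?min_l//; lra.
rewrite (Rintegral_eq_affine (u := - 1) (v := b)); last 2 first.
- by lra.
- by move=> x /andP[? ?]; rewrite dist_between ?min_r//; lra.
by rewrite /pcost/=; field.
Qed.

Lemma location_cost_pieces (S : {fset R}) s :
  s != [::] -> sorted <%R s -> {subset s <= `[0, 1]} -> S =i s ->
  location_cost S = \sum_(q <- pieces s) pcost q.
Proof.
case: s => // a l _ /= al s01 Ss; rewrite /location_cost.
have -> : [set` S] = [set` a :: l] by apply/seteqP; split => y /=; rewrite Ss.
have /s01 : a \in a :: l by rewrite mem_head.
rewrite in_itv/= => /andP[a0 a1].
rewrite (Rintegral_itv_split (b := a)); [|exact: continuous_dist|exact/andP].
rewrite Rintegral_dist_gaps//; last first.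
  by apply/allP => y /s01; rewrite in_itv/= => /andP[].
rewrite big_cons; congr (_ + _).
rewrite (Rintegral_eq_affine (u := - 1) (v := a))//; last first.
  by move=> x /andP[_ xa]; rewrite dist_left//; lra.
by rewrite /pcost/=; field.
Qed.

Lemma sum_length_gaps a l : \sum_(q <- gaps a l) q.2 = 1 - a.
Proof.
elim: l a => [|b l IH] a /=; first by rewrite big_seq1.
by rewrite big_cons IH/=; lra.
Qed.

Lemma sum_length_pieces s : s != [::] -> \sum_(q <- pieces s) q.2 = 1.
Proof.
by case: s => // a l _; rewrite big_cons sum_length_gaps /= addrC subrK.
Qed.

(* An end piece behaves as half of an interior piece of twice its length. *)
Definition weight q : R := if q.1 then 2^-1 else 1.

Lemma sum_weight_gaps a l : \sum_(q <- gaps a l) weight q = (size l)%:R + 2^-1.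
Proof.
elim: l a => [|b l IH] a /=; first by rewrite big_seq1 /weight/= add0r.
by rewrite big_cons IH /weight/= -natr1; lra.
Qed.

Lemma sum_weight_pieces s :
  s != [::] -> \sum_(q <- pieces s) weight q = (size s)%:R.
Proof.
case: s => // a l _; rewrite big_cons sum_weight_gaps/= /weight/=.
by rewrite -(natr1 (size l)); lra.
Qed.

(** The slack is a multiple of [(L - c)^2] for an interior piece of length L, of [(2 L - c)^2] for
    an end piece. The lower bound is affine in length and weight, whose totals are known. *)
Lemma pcost_tangent q (c : R) : 0 < c ->
  (2 * q.2 * c - weight q * c ^+ 2) / 4 <= pcost q.
Proof.
case: q => -[] L c0; rewrite /pcost/weight/=.
  by have := sqr_ge0 (2 * L - c); nra.
by have := sqr_ge0 (L - c); nra.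
Qed.

Lemma pieces_cost_ge s : s != [::] ->
  (4 * (size s)%:R)^-1 <= \sum_(q <- pieces s) pcost q.
Proof.
move=> s0; have n0 : 0 < (size s)%:R :> R by rewrite ltr0n lt0n size_eq0.
(* With total length 1 and total weight n, the bound [(2 c - n c^2) / 4] is largest at [c = 1/n]. *)
pose c : R := (size s)%:R^-1.
have c0 : 0 < c by rewrite invr_gt0.
have : \sum_(q <- pieces s) (2 * q.2 * c - weight q * c ^+ 2) / 4 <=
    \sum_(q <- pieces s) pcost q by apply: ler_sum => q _; exact: pcost_tangent.
apply: le_trans; rewrite -mulr_suml sumrB -!mulr_suml -mulr_sumr.
rewrite sum_length_pieces// sum_weight_pieces// /c le_eqVlt; apply/orP; left.
by apply/eqP; field; rewrite gt_eqF.
Qed.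

End Pieces.

(** * Cutting a piece, and the long-term cost *)

Lemma perm_cons_cat (T : eqType) (x : T) (s u v : seq T) :
  perm_eq s (u ++ v) -> perm_eq (x :: s) (u ++ x :: v).
Proof.
by move=> suv; rewrite perm_sym -cat1s perm_catCA/= perm_cons perm_sym.
Qed.

Section Insertion.
Context {R : realType}.
Implicit Types (a b p t : R) (l s : seq R) (q : bool * R).

(** A new point only affects the piece it falls into. Permutations are harmless, as only sums over
    pieces matter. *)
Lemma gaps_insert a l p : path <%R a l -> a < p -> p \notin l ->
  exists l' q t r, [/\ path <%R a l', l' =i p :: l,
    perm_eq (gaps a l) (q :: r) & perm_eq (gaps a l') (split_piece q t ++ r)].
Proof.
elim: l a => [|b l IH] a /=.
  move=> _ ap _; exists [:: p], (true, 1 - a), (1 - p), [::]; split => //=.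
    by rewrite ap.
  rewrite /split_piece /= (_ : 1 - a - (1 - p) = p - a); last by ring.
  by rewrite (perm_catC [:: _] [:: _]).
move=> /andP[ab bl] ap; rewrite inE negb_or => /andP[pb pl].
have [ltpb|] := ltP p b.
  exists [:: p, b & l], (false, b - a), (p - a), (gaps b l); split => //=.
    by rewrite ap ltpb.
  by rewrite /split_piece/= (_ : b - a - (p - a) = b - p)//; ring.
rewrite le_eqVlt eq_sym (negPf pb)/= => bp.
have [l' [q [t [r [bl' l'E qr qr']]]]] := IH b bl bp pl.
exists (b :: l'), q, t, ((false, b - a) :: r); split => /=.
- by rewrite ab.
- by move=> x; rewrite inE l'E !inE orbCA.
- exact: (@perm_cons_cat _ _ _ [:: q] r qr).
- exact: perm_cons_cat qr'.
Qed.

Lemma pieces_insert s p : s != [::] -> sorted <%R s -> p \notin s ->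
  exists s' q t r, [/\ sorted <%R s', s' =i p :: s,
    perm_eq (pieces s) (q :: r) & perm_eq (pieces s') (split_piece q t ++ r)].
Proof.
case: s => // a l _ /= al; rewrite inE negb_or => /andP[pa pl].
have [ltpa|] := ltP p a.
  by exists [:: p, a & l], (true, a), p, (gaps a l); split; rewrite //= ltpa.
rewrite le_eqVlt eq_sym (negPf pa)/= => ap.
have [l' [q [t [r [al' l'E qr qr']]]]] := gaps_insert al ap pl.
exists (a :: l'), q, t, ((true, a) :: r); split => //=.
- by move=> x; rewrite inE l'E !inE orbCA.
- exact: (@perm_cons_cat _ _ _ [:: q] r qr).
- exact: perm_cons_cat qr'.
Qed.

(** Counterpart of [gaps_insert] with the piece prescribed instead of the point; it supplies
    competitors for the minimization. *)
Lemma gaps_cut a l q t : path <%R a l -> all (fun x => x <= 1) l ->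
  q \in gaps a l -> 0 < t < q.2 ->
  exists p l' r, [/\ path <%R a l', l' =i p :: l, a < p <= 1,
    perm_eq (gaps a l) (q :: r) & perm_eq (gaps a l') (split_piece q t ++ r)].
Proof.
elim: l a => [|b l IH] a /=.
  move=> _ _; rewrite inE => /eqP -> /= /andP[t0 t1].
  have ap : a < 1 - t by lra.
  exists (1 - t), [:: 1 - t], [::]; split => //=; first by rewrite ap.
    by apply/andP; lra.
  rewrite /split_piece /= (_ : 1 - a - t = 1 - t - a); last by ring.
  rewrite (_ : 1 - (1 - t) = t); last by ring.
  by rewrite (perm_catC [:: _] [:: _]).
move=> /andP[ab bl] /andP[b1 l1]; rewrite inE => /predU1P[->|qg] tq.
  move: tq => /= /andP[t0 t1].
  have ap : a < a + t by lra.
  exists (a + t), [:: a + t, b & l], (gaps b l); split => //=.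
  - by rewrite ap bl andbT/=; lra.
  - by apply/andP; lra.
  - rewrite /split_piece/= (_ : b - a - t = b - (a + t)); last by ring.
    by rewrite (_ : a + t - a = t)//; ring.
have [p [l' [r [bl' l'E /andP[bp p1] qr qr']]]] := IH b bl l1 qg tq.
exists p, (b :: l'), ((false, b - a) :: r); split => /=.
- by rewrite ab.
- by move=> x; rewrite inE l'E !inE orbCA.
- by rewrite (lt_trans ab bp).
- exact: (@perm_cons_cat _ _ _ [:: q] r qr).
- exact: perm_cons_cat qr'.
Qed.

Lemma pieces_cut s q t : sorted <%R s -> {subset s <= `[0, 1]} ->
  q \in pieces s -> 0 < t < q.2 ->
  exists p s' r, [/\ sorted <%R s', s' =i p :: s, 0 <= p <= 1,
    perm_eq (pieces s) (q :: r) & perm_eq (pieces s') (split_piece q t ++ r)].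
Proof.
case: s => // a l /= al s01.
have /s01 : a \in a :: l by rewrite mem_head.
rewrite in_itv/= => /andP[a0 a1].
have l1 : all (fun x => x <= 1) l.
  apply/allP => y yl; have /s01 : y \in a :: l by rewrite inE yl orbT.
  by rewrite in_itv/= => /andP[].
rewrite inE => /predU1P[-> /= /andP[t0 ta]|qg tq].
  exists t, [:: t, a & l], (gaps a l); split => //=; first by rewrite ta.
  by apply/andP; lra.
have [p [l' [r [al' l'E /andP[ap p1] qr qr']]]] := gaps_cut al l1 qg tq.
exists p, (a :: l'), ((true, a) :: r); split => //=.
- by move=> x; rewrite inE l'E !inE orbCA.
- by rewrite (le_trans a0 (ltW ap)).
- exact: (@perm_cons_cat _ _ _ [:: q] r qr).
- exact: perm_cons_cat qr'.
Qed.

(** Completing the square in [t]: only the cut at [best_cut] achieves the full [gain]. *)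
Lemma pcost_split q t : \sum_(q' <- split_piece q t) pcost q' =
  pcost q - gain q + (if q.1 then 3 / 4 else 1 / 2) * (t - best_cut q) ^+ 2.
Proof.
case: q => -[] L; rewrite /split_piece !big_cons big_nil /pcost/gain/best_cut/=;
by field.
Qed.

Lemma card_fset_seq (S : {fset R}) s :
  sorted <%R s -> S =i s -> #|` S| = size s.
Proof.
move=> ss Ss; apply: perm_size.
by apply: uniq_perm; rewrite ?fset_uniq ?lt_sorted_uniq.
Qed.

Lemma fset_sorted_seq (S : {fset R}) : exists2 s, sorted <%R s & S =i s.
Proof.
exists (sort <=%R (enum_fset S)); last by move=> x; rewrite mem_sort.
by rewrite sort_lt_sorted fset_uniq.
Qed.

Lemma long_term_cost_lb n (S : {fset R}) : admissible n S ->
  (4 * n%:R)^-1 <= location_cost S.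
Proof.
move=> [S0 S01 Sn]; have [s ss Ss] := fset_sorted_seq S.
have s0 : s != [::].
  by have /fset0Pn[x] := S0; rewrite Ss; case: (s).
rewrite (location_cost_pieces s0)//; last by move=> x; rewrite -Ss; exact: S01.
apply: le_trans (pieces_cost_ge s0).
have sz : (0 < size s)%N by rewrite lt0n size_eq0.
rewrite lef_pV2 ?posrE ?mulr_gt0 ?ltr0n//; last first.
  by rewrite (leq_trans sz)// -(card_fset_seq ss Ss).
by rewrite ler_pM2l// ler_nat -(card_fset_seq ss Ss).
Qed.

Lemma gaps_progression (f : nat -> R) (m k : nat) :
  gaps (f m) [seq f i | i <- iota m.+1 k] =
  rcons [seq (false, f i.+1 - f i) | i <- iota m k] (true, 1 - f (m + k)%N).
Proof.
elim: k m => [|k IH] m /=; first by rewrite addn0.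
by rewrite IH addSnnS.
Qed.

Lemma long_term_costE n : (0 < n)%N -> long_term_cost R n = (4 * n%:R)^-1.
Proof.
case: n => // n _; have n0 : 0 < n.+1%:R :> R by rewrite ltr0n.
apply/eqP; rewrite eq_le; apply/andP; split; last first.
  apply: lb_le_inf; last by move=> _ [S /= + <-]; exact: long_term_cost_lb.
  exists (location_cost [fset (0 : R)]%fset), [fset 0]%fset => //; split.
  - by apply/fset0Pn; exists 0; rewrite inE.
  - by move=> x; rewrite inE => /eqP ->; rewrite in_itv/= lexx ler01.
  - by rewrite cardfs1.
(* These midpoints give equality in [pcost_tangent]: all interior pieces have length [c], both end
   pieces [c / 2], with [c = 1 / n.+1]. *)
pose f (i : nat) : R := (2 * i%:R + 1) / (2 * n.+1%:R).
pose s := [seq f i | i <- iota 0 n.+1].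
have fm i j : (i < j)%N -> f i < f j.
  move=> ij; rewrite ltr_pM2r ?invr_gt0 ?mulr_gt0// ltrD2r ltr_pM2l//.
  by rewrite ltr_nat.
have ss : sorted <%R s.
  rewrite sorted_map; apply: sub_sorted (iota_ltn_sorted 0 n.+1).
  by move=> i j; exact: fm.
have s01 : {subset s <= `[0, 1]}.
  move=> x /mapP[i]; rewrite mem_iota add0n => /andP[_ lin] ->.
  rewrite in_itv/= /f divr_ge0//=.
  rewrite ler_pdivrMr ?mulr_gt0// mul1r.
  have : i.+1%:R <= n.+1%:R :> R by rewrite ler_nat.
  by rewrite -(natr1 i); lra.
pose S := [fset x in s]%fset.
have Ss : S =i s by move=> x; rewrite /S; move: s {S ss s01} => s; rewrite inE.
have -> : (4 * n.+1%:R)^-1 = location_cost S.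
  rewrite (location_cost_pieces _ ss s01 Ss)// /s /= big_cons gaps_progression.
  rewrite -cats1 big_cat big_seq1 big_map/=.
  rewrite (eq_bigr (fun=> (2 * n.+1%:R) ^- 2)).
    rewrite big_const_seq count_predT size_iota iter_addr_0 /pcost/= /f add0n.
    rewrite -[_ *+ n]mulr_natr -(natr1 n); field.
    by rewrite natr1 gt_eqF.
  move=> i _; rewrite /pcost /f/= -(natr1 i); field.
  by rewrite gt_eqF.
apply: ge_inf.
  by exists (4 * n.+1%:R)^-1 => _ [T /= + <-]; exact: long_term_cost_lb.
exists S => //; split.
- by apply/fset0Pn; exists (f 0%N); rewrite Ss /s inE eqxx.
- by move=> x; rewrite Ss; exact: s01.
- by rewrite (card_fset_seq ss Ss) size_map size_iota.
Qed.

End Insertion.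

(** * The short-term problem as a greedy procedure *)

Section GreedyStep.
Context {R : realType}.

(* [inl k] is an end piece of length 3^-k / 2 and [inr (k, j)] an interior
   piece of length 3^-k 2^-j: optimal cuts only ever produce these. *)
Definition tag := (nat + nat * nat)%type.
Implicit Types (u v w : tag) (σ τ : seq tag) (S T : {fset R}).

Definition piece_of u : bool * R :=
  match u with
  | inl k => (true, 3^-1 ^+ k / 2)
  | inr (k, j) => (false, 3^-1 ^+ k * 2^-1 ^+ j)
  end.

(** Two thirds of [3^-k / 2] is [3^-(k+1)], so the interior part cut off an end piece opens class
    [k.+1]. *)
Definition kids u : seq tag :=
  match u with
  | inl k => [:: inl k.+1; inr (k.+1, 0%N)]
  | inr (k, j) => [:: inr (k, j.+1); inr (k, j.+1)]
  end.

Definition tag_gain u : R := gain (piece_of u).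

(** A relation, since ties between equal gains may be broken in any way. *)
Definition greedy_step σ τ :=
  exists u, [/\ u \in σ, τ = kids u ++ rem u σ &
    forall v, v \in σ -> tag_gain v <= tag_gain u].

Definition tagging S σ :=
  exists s, [/\ s != [::], sorted <%R s, {subset s <= `[0, 1]}, S =i s &
    perm_eq (pieces s) (map piece_of σ)].

Lemma piece_of_gt0 u : 0 < (piece_of u).2.
Proof. by case: u => [k|[k j]] /=; rewrite mulr_gt0 ?exprn_gt0 ?invr_gt0. Qed.

Lemma tag_gain_gt0 u : 0 < tag_gain u.
Proof.
by rewrite divr_gt0 ?exprn_gt0 ?piece_of_gt0//; case: ifP.
Qed.

Lemma best_cut_itv u : 0 < best_cut (piece_of u) < (piece_of u).2.
Proof.
have u0 := piece_of_gt0 u; rewrite /best_cut.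
by case: (piece_of u).1; apply/andP; lra.
Qed.

Lemma map_kids u :
  map piece_of (kids u) = split_piece (piece_of u) (best_cut (piece_of u)).
Proof.
case: u => [k|[k j]]; rewrite /split_piece /best_cut /= !exprS ?expr0;
by congr [:: (_, _); (_, _)]; field.
Qed.

Lemma tagging_cost S σ : tagging S σ ->
  location_cost S = \sum_(u <- σ) pcost (piece_of u).
Proof.
move=> [s [s0 ss s01 Ss sσ]].
by rewrite (location_cost_pieces s0 ss s01 Ss) (perm_big _ sσ) big_map.
Qed.

Lemma seq_argmax (I : eqType) (f : I -> R) (r : seq I) : r != [::] ->
  exists2 x, x \in r & forall y, y \in r -> f y <= f x.
Proof.
elim: r => // x [|y r] IH _.
  by exists x; rewrite ?mem_head// => z; rewrite inE => /eqP ->.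
have [//|z zr zM] := IH; have [fxz|fzx] := leP (f x) (f z).
  by exists z; [rewrite inE zr orbT|move=> w; rewrite inE => /predU1P[->|/zM]].
exists x; rewrite ?mem_head// => w; rewrite inE => /predU1P[->//|/zM wz].
exact: le_trans wz (ltW fzx).
Qed.

(** The best cut of a piece of largest gain is a competitor. The minimizer adds exactly one point,
    and by [pcost_split] it can only match this competitor by making a best cut of a piece whose
    gain is also largest. *)
Lemma minimizer_greedy_step S T σ n : #|` S| = n -> tagging S σ ->
  minimizer (fun A => admissible n.+1 A /\ (S `<=` A)%fset) T ->
  exists τ, [/\ #|` T| = n.+1, tagging T τ & greedy_step σ τ].
Proof.
move=> Sn tS [[[T0 T01 Tn] ST] Tmin].
have [s [s0 ss s01 Ss sσ]] := tS.
have costS := location_cost_pieces s0 ss s01 Ss.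
have σ0 : σ != [::].
  apply: contra_neq s0 => σE; move: sσ; rewrite σE => /perm_size.
  by case: (s).
have mem_pieces u : u \in σ -> piece_of u \in pieces s.
  by move=> uσ; rewrite (perm_mem sσ) map_f.
have [u uσ umax] := seq_argmax tag_gain σ0.
have costT : location_cost T <= location_cost S - tag_gain u.
  have [p [s' [r [ss' s'E p01 qr qr']]]] :=
    pieces_cut ss s01 (mem_pieces u uσ) (best_cut_itv u).
  have s'0 : s' != [::].
    by apply: contraTneq (mem_head p s) => s'0; rewrite -s'E s'0.
  have s'01 : {subset s' <= `[0, 1]}.
    by move=> x; rewrite s'E inE => /predU1P[->|/s01//]; rewrite in_itv.
  have pS : (p |` S)%fset =i s' by move=> x; rewrite in_fset1U s'E inE Ss.
  have -> : location_cost S - tag_gain u = location_cost (p |` S)%fset.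
    rewrite costS (location_cost_pieces s'0 ss' s'01 pS) (perm_big _ qr).
    rewrite (perm_big _ qr') big_cat pcost_split big_cons/= subrr expr0n/=.
    by rewrite mulr0 addr0 addrAC.
  apply: Tmin; split; last by rewrite fsubsetU1.
  split; first by apply/fset0Pn; exists p; rewrite fset1U1.
    by move=> x; rewrite pS; exact: s'01.
  by rewrite cardfsU1 Sn; case: (_ \notin _).
(* Keeping [S] unchanged would forgo a positive gain. *)
have [p pT pS] : exists2 p, p \in T & p \notin S.
  apply/fsubsetPn; apply: contraTN costT => TS.
  have -> : T = S by apply/eqP; rewrite eqEfsubset TS.
  by rewrite -ltNge; have := tag_gain_gt0 u; lra.
have {ST} TE : (p |` S)%fset = T.
  apply/eqP; rewrite eqEfcard fsubUset fsub1set pT ST/=.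
  by rewrite cardfsU1 pS Sn.
have [s' [q [t [r [ss' s'E qr qr']]]]] : exists s' q t r,
    [/\ sorted <%R s', s' =i p :: s,
    perm_eq (pieces s) (q :: r) & perm_eq (pieces s') (split_piece q t ++ r)].
  by apply: pieces_insert; rewrite // -Ss.
have s'0 : s' != [::].
  by apply: contraTneq (mem_head p s) => s'0; rewrite -s'E s'0.
have Ts' : T =i s' by move=> x; rewrite -TE in_fset1U s'E inE Ss.
have s'01 : {subset s' <= `[0, 1]} by move=> x; rewrite -Ts'; exact: T01.
have : q \in map piece_of σ by rewrite -(perm_mem sσ) (perm_mem qr) mem_head.
move=> /mapP[v vσ qE]; have vu := umax v vσ.
move: costT; rewrite costS (location_cost_pieces s'0 ss' s'01 Ts').
rewrite (perm_big _ qr) (perm_big _ qr') big_cat pcost_split big_cons/=.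
have -> : gain q = tag_gain v by rewrite qE.
set c : R := if _ then _ else _; set d := (t - _) => dle.
have c0 : 0 < c by rewrite /c; case: ifP; rewrite divr_gt0.
have cd0 : 0 <= c * d ^+ 2 by rewrite mulr_ge0 ?sqr_ge0// ltW.
(* [c * d ^+ 2 <= tag_gain v - tag_gain u], which is at most 0. *)
have /eqP : c * d ^+ 2 = 0 by lra.
rewrite mulf_eq0 (gt_eqF c0) sqrf_eq0/= subr_eq0 => /eqP tE.
exists (kids v ++ rem v σ); split.
- by rewrite -TE cardfsU1 pS Sn.
- exists s'; split=> //; apply: perm_trans qr' _.
  rewrite map_cat map_kids -qE -tE perm_cat2l -(perm_cons q).
  rewrite -(permPl qr) (permPl sσ) qE -map_cons; apply: perm_map.
  exact: perm_to_rem.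
- exists v; split=> // w wσ; apply: le_trans (umax w wσ) _.
  by lra.
Qed.

Lemma minimizer_one S :
  minimizer (fun A => admissible 1 A /\ (fset0 `<=` A)%fset) S ->
  #|` S| = 1%N /\ tagging S [:: inl 0%N; inl 0%N].
Proof.
move=> [[[S0 S01 S1] _] Smin].
have S1E : #|` S| = 1%N by apply/eqP; rewrite eqn_leq S1 cardfs_gt0.
split=> //; have /cardfs1P[p SE] := introT eqP S1E.
have cost1 (x : R) : 0 <= x <= 1 -> location_cost [fset x]%fset =
    x ^+ 2 / 2 + (1 - x) ^+ 2 / 2.
  move=> x01; rewrite (@location_cost_pieces _ _ [:: x])//.
  - by rewrite big_cons big_seq1.
  - by move=> y; rewrite inE => /eqP ->; rewrite in_itv.
  - by move=> y; rewrite !inE.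
have p01 : 0 <= p <= 1.
  by have := S01 p; rewrite SE inE eqxx in_itv/= => /(_ isT).
have h01 : 0 <= (2^-1 : R) <= 1 by apply/andP; lra.
have hadm : admissible 1 [fset (2^-1 : R)]%fset.
  split; rewrite ?cardfs1//; first by apply/fset0Pn; exists 2^-1; rewrite inE.
  by move=> x; rewrite inE => /eqP ->; rewrite in_itv.
have := Smin _ (conj hadm (fsub0set _)); rewrite {1}SE !cost1// => costp.
have pE : p = 2^-1 by nra.
exists [:: p]; split=> //.
- by move=> x; rewrite inE => /eqP ->; rewrite in_itv.
- by move=> x; rewrite SE !inE.
- by rewrite pE /= !expr0 div1r (_ : 1 - 2^-1 = 2^-1)//; field.
Qed.

Lemma short_term_tagging (Sigma : nat -> {fset R}) :
  short_term_solution Sigma ->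
  exists f : nat -> seq tag, [/\ f 0%N = [:: inl 0%N; inl 0%N],
    forall n, greedy_step (f n) (f n.+1) &
    forall n, location_cost (Sigma n.+1) = \sum_(u <- f n) pcost (piece_of u)].
Proof.
move=> [Sigma0 Sigmamin].
pose good (x : nat * seq tag) :=
  #|` Sigma x.1.+1| = x.1.+1 /\ tagging (Sigma x.1.+1) x.2.
(* Dependent choice needs a successor of every state, hence the implication from [good x]. *)
pose next (x y : nat * seq tag) :=
  y.1 = x.1.+1 /\ (good x -> good y /\ greedy_step x.2 y.2).
have ex_next x : {y | next x y}.
  apply: cid; have [[gx tx]|ngx] := pselect (good x); last first.
    by exists (x.1.+1, x.2); split=> // /ngx.
  have [τ [cτ tτ sτ]] := minimizer_greedy_step gx tx (Sigmamin x.1.+1).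
  by exists (x.1.+1, τ).
have [f [f0 fnext]] := dependent_choice ex_next (0%N, [:: inl 0%N; inl 0%N]).
have f1 n : (f n).1 = n by elim: n => [|n IH]; rewrite ?f0// (fnext n).1 IH.
have fgood n : good (f n).
  elim: n => [|n /(fnext n).2[]//]; rewrite f0.
  by apply: minimizer_one; rewrite -Sigma0; exact: Sigmamin.
exists (fun n => (f n).2); split=> [|n|n]; first by rewrite f0.
- by have [] := (fnext n).2 (fgood n).
- by apply: tagging_cost; have [_] := fgood n; rewrite f1.
Qed.

End GreedyStep.

(** * Asymptotics of the greedy cost *)

Section GreedyAsymptotics.
Context {R : realType}.
Variable f : nat -> seq tag.
Hypothesis f0 : f 0%N = [:: inl 0%N; inl 0%N].
Hypothesis fstep : forall n, greedy_step (R := R) (f n) (f n.+1).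

Let len (u : tag) : R := (piece_of u).2.
Let g (u : tag) : R := tag_gain u.
Let cost (n : nat) : R := \sum_(u <- f n) pcost (piece_of u).

Lemma sum_step (phi : tag -> R) n :
  exists u, [/\ u \in f n, f n.+1 = kids u ++ rem u (f n),
    forall v, v \in f n -> g v <= g u &
    \sum_(v <- f n.+1) phi v =
      \sum_(v <- f n) phi v - phi u + \sum_(v <- kids u) phi v].
Proof.
have [u [uf fE umax]] := fstep n; exists u; split=> //.
rewrite [in RHS](perm_big _ (perm_to_rem uf)) big_cons fE big_cat/=.
by rewrite [phi u + _]addrC addrK addrC.
Qed.

(** The increment does not depend on the piece cut, so the total depends only on the number of
    steps. Total length, weight and class masses are instances. *)
Lemma sum_additive (phi : tag -> R) (d : R) :
  (forall u, \sum_(v <- kids u) phi v = phi u + d) ->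
  forall n, \sum_(u <- f n) phi u = 2 * phi (inl 0%N) + n%:R * d.
Proof.
move=> phid; elim=> [|n IH]; first by rewrite f0 big_cons big_seq1; ring.
by have [u [_ _ _ ->]] := sum_step phi n; rewrite phid IH -natr1; ring.
Qed.

Lemma sum_len n : \sum_(u <- f n) len u = 1.
Proof.
rewrite (@sum_additive len 0); first by rewrite /len /= expr0; field.
move=> u; rewrite -(big_map piece_of predT (fun q : bool * R => q.2)) map_kids.
by rewrite big_cons big_seq1 /len/=; ring.
Qed.

Lemma sum_weight n : \sum_(u <- f n) weight (piece_of u) = n.+1%:R :> R.
Proof.
rewrite (@sum_additive (fun u => weight (piece_of u)) 1).
  by rewrite /weight/= -(natr1 n); field.
by case=> [k|[k j]]; rewrite big_cons big_seq1 /weight/=; ring.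
Qed.

Lemma cost_step n : exists u, [/\ u \in f n, f n.+1 = kids u ++ rem u (f n),
    forall v, v \in f n -> g v <= g u & cost n.+1 = cost n - g u].
Proof.
have [u [uf fE umax costE]] := sum_step (fun u => pcost (piece_of u)) n.
exists u; split=> //; rewrite /cost costE.
rewrite -[X in _ + X](big_map piece_of predT pcost) map_kids pcost_split.
by rewrite subrr expr0n/= mulr0 addr0 addrA subrK.
Qed.

Lemma pcost_piece_ge0 u : 0 <= pcost (piece_of u) :> R.
Proof. by rewrite /pcost divr_ge0 ?sqr_ge0//; case: ifP. Qed.

Lemma cost_ge0 n : 0 <= cost n.
Proof. by apply: sumr_ge0 => u _; exact: pcost_piece_ge0. Qed.

(* The gain is at least [len u ^+ 2 / 8], while every piece has length at most
   [2 * len u], so that the cost is at most [len u]. *)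
Lemma cost_decrease n : cost n.+1 <= cost n - cost n ^+ 2 / 8.
Proof.
have [u [uf _ umax ->]] := cost_step n.
have len0 v : 0 < len v := piece_of_gt0 v.
have gE v : len v ^+ 2 / 8 <= g v <= len v ^+ 2 / 3.
  have := sqr_ge0 (len v); rewrite /g /tag_gain /gain -/(len v).
  by case: ifP => _ ?; apply/andP; lra.
have lenu v : v \in f n -> len v <= 2 * len u.
  move=> /umax vu; have /andP[gv _] := gE v; have /andP[_ gu] := gE u.
  have : len v ^+ 2 <= (2 * len u) ^+ 2.
    by rewrite exprMn; have := sqr_ge0 (len u); lra.
  by rewrite ler_sqr ?nnegrE ?mulr_ge0// ltW.
have : cost n <= len u.
  rewrite -[leRHS]mul1r -(sum_len n) mulr_suml /cost big_seq [leRHS]big_seq.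
  apply: ler_sum => v vf; rewrite /pcost -/(len v).
  have := lenu v vf; have := len0 v; have := len0 u.
  by case: ifP => _ *; nra.
have := cost_ge0 n; have /andP[gu _] := gE u; have := len0 u => u0 c0 cu.
have : cost n ^+ 2 <= len u ^+ 2 by rewrite ler_sqr// nnegrE ltW.
by lra.
Qed.

(** For positive terms, [x' <= x - x^2 / 8] makes [1 / x] grow by at least 1/8 per step. *)
Lemma cost_bounded n : n.+1%:R * cost n <= 8.
Proof.
elim: n => [|n IH].
  by rewrite /cost f0 big_cons big_seq1 /pcost/= expr0; lra.
have := cost_decrease n; have := cost_ge0 n; move: IH.
rewrite -(natr1 n.+1); set N : R := n.+1%:R.
have N1 : 1 <= N by rewrite ler1n.
move: (cost n) (cost n.+1) => x y Nx x0 yx.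
have : (N + 1) * y <= (N + 1) * (x - x ^+ 2 / 8).
  by rewrite ler_wpM2l//; lra.
move=> /le_trans; apply.
rewrite -(@ler_pM2l _ (N ^+ 2)) ?exprn_gt0//.
set z := N * x in Nx; have z0 : 0 <= z by rewrite mulr_ge0//; lra.
have -> : N ^+ 2 * ((N + 1) * (x - x ^+ 2 / 8)) =
    (N + 1) * (N * z - z ^+ 2 / 8).
  by rewrite /z; field.
(* The two sides of the goal differ by one eighth of this product plus [z^2 / 8]. *)
have h1 : 0 <= (8 - z) * (N * (8 * N - z)).
  by rewrite !mulr_ge0//; lra.
by have := sqr_ge0 z; lra.
Qed.

(* [class_mass i] is conserved; it is carried by the interior pieces
   [inr (i, _)] and by the end pieces that still have to produce them. *)
Definition class_mass (i : nat) (u : tag) : R :=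
  match u with
  | inl k => if (k < i)%N then 3^-1 ^+ i else 0
  | inr (k, j) => if k == i then 3^-1 ^+ k * 2^-1 ^+ j else 0
  end.

Lemma sum_class_mass i n : (0 < i)%N ->
  \sum_(u <- f n) class_mass i u = 2 * 3^-1 ^+ i.
Proof.
move=> i0; rewrite (@sum_additive _ 0) /= ?i0; first by ring.
case=> [k|[k j]]; rewrite big_cons big_seq1/=; last first.
  by case: ifP => _; rewrite ?exprS; field.
rewrite addr0; case: (ltngtP k.+1 i) => [ki|ki|->].
- by rewrite addr0.
- by rewrite addr0.
- by rewrite expr0 mulr1 add0r.
Qed.

(** [(x - c)^2 / (x c)] depends only on the ratio [x / c]; at 9/10 and at 10/9 it equals 1/90, above
    1/100. *)
Lemma near_ratio (x c : R) : 0 < x -> 0 < c -> (x - c) ^+ 2 < x * c / 100 ->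
  9 / 10 * c < x < 10 / 9 * c.
Proof.
move=> x0 c0 h; apply/andP; split; rewrite ltNge; apply/negP => xc; nra.
Qed.

(* The ratio of [3^-1 2^-j] to [3^-2 2^-i] is at least 3/2 or at most 3/4. *)
Lemma class_dichotomy (i j : nat) (c : R) : 0 < c ->
  let x := 3^-1 ^+ 1 * 2^-1 ^+ j in let y := 3^-1 ^+ 2 * 2^-1 ^+ i in
  x * c / 100 <= (x - c) ^+ 2 \/ y * c / 100 <= (y - c) ^+ 2.
Proof.
move=> c0 x y.
have x0 : 0 < x by rewrite mulr_gt0 ?exprn_gt0 ?invr_gt0.
have y0 : 0 < y by rewrite mulr_gt0 ?exprn_gt0 ?invr_gt0.
have [|/(near_ratio x0 c0)/andP[cx xc]] := leP (x * c / 100) _; first by left.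
have [|/(near_ratio y0 c0)/andP[cy yc]] := leP (y * c / 100) _; first by right.
have half_le m k : (m <= k)%N -> 2^-1 ^+ k <= 2^-1 ^+ m :> R.
  by move=> mk; rewrite ler_wiXn2l// ?invr_ge0// invf_le1// ler1n.
(* At this point [x / y] lies between 81/100 and 100/81. *)
exfalso; have [ji|ij] := leqP j i.+1.
  have := half_le _ _ ji; rewrite exprS => h.
  have : 3 / 2 * y <= x by rewrite /x /y expr1 expr2; lra.
  by lra.
have := half_le _ _ ij; rewrite !exprS => h.
have : x <= 3 / 4 * y by rewrite /x /y expr1 expr2; lra.
by lra.
Qed.

(** Sharpens [pcost_tangent] when class [i] stays away from [c]: its interior pieces have slack
    [(x - c)^2 / 4], at least [x c / 400]. An end piece still carrying class mass has length at
    least 1/6, hence slack [(2 x - c)^2 / 8], at least 1/288. *)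
Lemma pcost_class (i : nat) (u : tag) (c : R) : 0 < c <= 1 / 6 ->
  (i == 1) || (i == 2) ->
  (forall j, let x := 3^-1 ^+ i * 2^-1 ^+ j in x * c / 100 <= (x - c) ^+ 2) ->
  (2 * len u * c - weight (piece_of u) * c ^+ 2) / 4 +
    class_mass i u * (c / 400) <= pcost (piece_of u).
Proof.
move=> /andP[c0 c6] i12 hc.
case: u => [k|[k j]]; rewrite /pcost /weight /len/=; last first.
  have [->|_] := eqVneq k i.
    by have /= := hc j; move: (3^-1 ^+ i * _) => x; lra.
  by move: (3^-1 ^+ k * _) => x; have := sqr_ge0 (x - c); lra.
set x := 3^-1 ^+ k / 2; have [ki|_] := ltnP k i; last first.
  by have := sqr_ge0 (2 * x - c); lra.
have [x6 m3] : 1 / 6 <= x /\ (3^-1 ^+ i : R) <= 1 / 3.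
  rewrite /x; case/orP: i12 ki => /eqP ->; case: k {x} => [|[|k]]// _;
  by rewrite ?expr0 ?expr1 ?expr2; lra.
set m : R := 3^-1 ^+ i in m3 *.
have m0 : 0 <= m by rewrite exprn_ge0 ?invr_ge0.
have : m * c <= 1 / 18 by nra.
have : (1 / 6) ^+ 2 <= (2 * x - c) ^+ 2.
  by rewrite ler_sqr ?nnegrE; lra.
by lra.
Qed.

(** One of the classes 1 and 2 stays away from [c = 1 / n.+1]. Its mass is at least 2/9, so the cost
    exceeds [c / 4] by at least [(2/9) c / 400 = (c / 4) / 450]. *)
Lemma cost_ratio_gt1 n : (5 <= n)%N -> 1 + 1 / 450 <= 4 * n.+1%:R * cost n.
Proof.
move=> n5; set c : R := n.+1%:R^-1.
have N0 : 0 < n.+1%:R :> R by rewrite ltr0n.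
have c0 : 0 < c by rewrite invr_gt0.
have c6 : 0 < c <= 1 / 6 by rewrite c0 /c div1r lef_pV2 ?posrE// ler_nat.
have [i [i12 hi]] : exists i, (i == 1)%N || (i == 2)%N /\
    forall j, let x := 3^-1 ^+ i * 2^-1 ^+ j in x * c / 100 <= (x - c) ^+ 2.
  have [h1|/existsNP[j jh]] := pselect (forall j,
    let x := 3^-1 ^+ 1 * 2^-1 ^+ j in x * c / 100 <= (x - c) ^+ 2).
    by exists 1%N.
  by exists 2%N; split=> // k; have [/jh|] := class_dichotomy k j c0.
have i0 : (0 < i)%N by case/orP: i12 => /eqP ->.
have : \sum_(u <- f n) ((2 * len u * c - weight (piece_of u) * c ^+ 2) / 4 +
    class_mass i u * (c / 400)) <= cost n.
  by apply: ler_sum => u _; exact: pcost_class.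
rewrite big_split/= -!mulr_suml sumrB -!mulr_suml -mulr_sumr.
rewrite sum_len sum_weight sum_class_mass//.
have : 1 / 9 <= (3^-1 : R) ^+ i.
  by case/orP: i12 => /eqP ->; rewrite ?expr2; lra.
set m := _ ^+ i => mi.
have -> : n.+1%:R * c ^+ 2 = c by rewrite expr2 mulrA divff ?mul1r ?gt_eqF.
move=> costn; have h : c * (1 + 1 / 450) <= 4 * cost n by nra.
rewrite -(ler_pM2l c0) (_ : c * (4 * n.+1%:R * cost n) = 4 * cost n)//.
by rewrite /c; field; rewrite gt_eqF.
Qed.

(** The pieces created by a cut never join those currently of largest gain, so each step uses up one
    of the latter. *)
Lemma gain_kids u v : v \in kids u -> g v < g u.
Proof.
have p0 k j : 0 < (3^-1 ^+ k * 2^-1 ^+ j : R) ^+ 2.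
  by rewrite exprn_gt0// mulr_gt0 ?exprn_gt0 ?invr_gt0.
rewrite /g /tag_gain /gain.
case: u => [k|[k j]]; rewrite !inE => /orP[]/eqP -> /=; rewrite !exprS ?expr0;
by [have := p0 k 0%N; rewrite expr0; nra|have := p0 k j; nra].
Qed.

Section Block.
Variable j : nat.
Let rho : R := g (inr (1%N, j)).
Let below n := all (fun v => g v <= rho) (f n).

Lemma cost_block (a m : nat) :
  below a -> (m <= count (fun v => g v == rho) (f a))%N ->
  cost (a + m) = cost a - m%:R * rho.
Proof.
(* The induction carries the count: while it is positive the largest gain is exactly [rho], and the
   step cuts one such piece. *)
move=> ba ma; suff : [/\ below (a + m),
    (count (fun v => g v == rho) (f (a + m)) =
      count (fun v => g v == rho) (f a) - m)%N
    & cost (a + m) = cost a - m%:R * rho] by case.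
elim: m ma => [|m IH] ma; first by rewrite addn0 subn0 mul0r subr0; split.
have [/allP bm cm costm] := IH (ltnW ma).
have [u [uf fE umax costE]] := cost_step (a + m).
have gu : g u = rho.
  apply/eqP; rewrite eq_le bm//=.
  have /hasP[v vf /eqP <-] : has (fun v => g v == rho) (f (a + m)).
    by rewrite has_count cm subn_gt0.
  exact: umax.
have kidlt v : v \in kids u -> g v < rho by rewrite -gu; exact: gain_kids.
rewrite addnS; split.
- rewrite /below fE all_cat; apply/andP; split; apply/allP => v.
    by move/kidlt/ltW.
  by move/mem_rem/bm.
- rewrite fE count_cat (_ : count _ (kids u) = 0)%N; last first.
    apply/eqP; rewrite eqn0Ngt -has_count; apply/hasPn => v /kidlt.
    by rewrite lt_neqAle => /andP[].
  move: cm; rewrite (permP (perm_to_rem uf))/= gu eqxx => cm.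
  by rewrite subnS -cm.
- by rewrite costE costm gu -natr1; ring.
Qed.

(** Otherwise every step would lower the cost by more than [rho], against [cost_ge0]. *)
Lemma below_eventually : exists n, below n.
Proof.
apply: contrapT => /forallNP nb.
have rho0 : 0 < rho := tag_gain_gt0 _.
have drop n : cost n <= cost 0%N - n%:R * rho.
  elim: n => [|n IH]; first by rewrite mul0r subr0.
  have [u [_ _ umax ->]] := cost_step n.
  have /negP/allPn[v vf] := nb n; rewrite -ltNge => rv.
  by have := umax v vf; rewrite -natr1; lra.
have := drop (Num.bound (cost 0%N / rho)); apply/negP; rewrite -ltNge.
apply: lt_le_trans (cost_ge0 _); rewrite subr_lt0 -ltr_pdivrMr//.
by rewrite archi_boundP// divr_ge0 ?cost_ge0// ltW.
Qed.

Lemma gain_class_le i : (g (inr (1%N, i)) <= rho) = (j <= i)%N.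
Proof.
rewrite /rho /g /tag_gain /gain/= ler_pM2r ?invr_gt0// !exprMn -!exprM.
rewrite ler_pM2l ?exprn_gt0 ?invr_gt0// ler_iXn2l ?invr_gt0//.
  by rewrite leq_pmul2r.
by rewrite invf_lt1// ltr1n.
Qed.

(** Let [a] be the first index with [below a]. Earlier cuts all have gain above [rho], so no class 1
    piece has index beyond [j], and [below a] leaves none before [j]. The conserved mass 2/3 thus
    consists of pieces of length [3^-1 2^-j], [2^(j+1)] in number. *)
Lemma exists_block :
  exists a, below a /\ (2 ^ j.+1 <= count (fun v => g v == rho) (f a))%N.
Proof.
have [a ba amin] := ex_minnP below_eventually.
exists a; split=> //.
have small n : (n <= a)%N -> forall i, inr (1%N, i) \in f n -> (i <= j)%N.
  elim: n => [|n IH] na i; first by rewrite f0.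
  have [u [uf fE umax _]] := cost_step n.
  have gu : rho < g u.
    have /allPn[v vf] : ~~ below n.
      by apply: contraTN na => /amin; rewrite -leqNgt.
    by rewrite -ltNge => /lt_le_trans; apply; exact: umax.
  rewrite fE mem_cat => /orP[|/mem_rem/(IH (ltnW na))//].
  case: u gu {uf fE umax} => [k|[k l]] gu; rewrite !inE => /orP[]/eqP//.
  - by case=> _ ->.
  - by case=> kE ->; rewrite -kE in gu; rewrite ltnNge -gain_class_le -ltNge.
  - by case=> kE ->; rewrite -kE in gu; rewrite ltnNge -gain_class_le -ltNge.
have massE v : v \in f a ->
    class_mass 1 v = if v == inr (1%N, j) then 3^-1 * 2^-1 ^+ j else 0.
  move=> vf; have := allP ba v vf; case: v vf => [[|k]|[k i]] vf //=.
    (* An uncut half of the interval has gain 1/12, above [rho <= 1/72]. *)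
    rewrite /rho /g /tag_gain /gain/= !expr0 expr1 leNgt => /negP[].
    have : 2^-1 ^+ j <= 1 :> R.
      by rewrite exprn_ile1 ?invr_ge0// invf_le1// ler1n.
    have : 0 <= 2^-1 ^+ j :> R by rewrite exprn_ge0 ?invr_ge0.
    by move: (2^-1 ^+ j : R) => x; nra.
  have [k1|k1 _] := eqVneq k 1; last first.
    by case: eqP => // -[kE]; rewrite kE eqxx in k1.
  subst k; rewrite gain_class_le => ji.
  have -> : i = j by apply/eqP; rewrite eqn_leq ji (small a).
  by rewrite eqxx expr1.
have := sum_class_mass a (ltn0Sn 0); rewrite big_seq (eq_bigr _ massE) -big_seq.
rewrite -big_mkcond big_const_seq iter_addr_0 expr1 => cnt.
have {cnt} cnt : count (eq_op^~ (inr (1%N, j))) (f a) = (2 ^ j.+1)%N.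
  move: cnt; rewrite -[_ *+ count _ _]mulr_natr exprVn.
  move: (count _ _) => N NE.
  have p0 : (2 ^+ j : R) != 0 by rewrite expf_neq0.
  apply/eqP; rewrite -(eqr_nat R) natrX exprS; apply/eqP.
  rewrite -[LHS](_ : 3^-1 / 2 ^+ j * N%:R * (3 * 2 ^+ j) = _); last by field.
  by rewrite NE; field.
by rewrite -cnt; apply: sub_count => v /= /eqP ->; rewrite eqxx.
Qed.

End Block.

Lemma size_greedy n : size (f n) = n.+2.
Proof.
elim: n => [|n IH]; first by rewrite f0.
have [u [uf -> _ _]] := cost_step n.
have -> : size (kids u ++ rem u (f n)) = (size (f n)).+1.
  by rewrite size_cat (perm_size (perm_to_rem uf))/=; case: (u) => [k|[k j]].
by rewrite IH.
Qed.

(* Over a block of [2 ^ j.+1] steps with the same gain [rho], the sequence is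
   quadratic with leading coefficient [- rho], and [rho * 4 ^ j = 1 / 72]. *)
Lemma cost_oscillation n0 : exists a b c, 
  [/\ (n0 <= a)%N, (n0 <= b)%N, (n0 <= c)%N &
  a.+1%:R * cost a - 2 * (b.+1%:R * cost b) + c.+1%:R * cost c = - (1 / 36)].
Proof.
have [a [ba cnt]] := exists_block n0.
have an : (n0 <= a)%N.
  (* [f a] has [a.+2] entries, at least [2 ^ n0.+1] of them in the block. *)
  have := leq_trans (ltn_expl n0.+1 (ltnSn 1)) (leq_trans cnt (count_size _ _)).
  by rewrite size_greedy !ltnS.
(* Beginning, middle and end of the block: the second difference is [- 2 rho 4^n0]. *)
exists a, (a + 2 ^ n0)%N, (a + 2 ^ n0.+1)%N; split=> //.
- by rewrite (leq_trans an)// leq_addr.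
- by rewrite (leq_trans an)// leq_addr.
rewrite !(cost_block (j := n0))//; last first.
  by rewrite (leq_trans _ cnt)// leq_pexp2l.
rewrite -!addSn !natrD !natrX exprS /g /tag_gain /gain /= expr1 exprVn.
have p0 : (2 ^+ n0 : R) != 0 by rewrite expf_neq0.
by field.
Qed.

End GreedyAsymptotics.

(** * Lower and upper limits of a bounded oscillating sequence *)

Section OscillatingSequences.
Context {R : realType}.
Implicit Types r : nat -> R.
Local Open Scope ereal_scope.

Lemma limn_einf_ge r (x : R) n0 : (forall n, (n0 <= n)%N -> (x <= r n)%R) ->
  x%:E <= limn_einf (fun n => (r n)%:E).
Proof.
move=> h; rewrite limn_einf_lim; apply: lime_ge; first exact: is_cvg_einfs.
exists n0 => // n /= n0n; apply: le_ereal_inf_tmp => _ [m /= nm] <-.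
by rewrite lee_fin h// (leq_trans n0n).
Qed.

Lemma limn_esup_le r (x : R) n0 : (forall n, (n0 <= n)%N -> (r n <= x)%R) ->
  limn_esup (fun n => (r n)%:E) <= x%:E.
Proof.
move=> h; rewrite limn_esup_lim; apply: lime_le; first exact: is_cvg_esups.
exists n0 => // n /= n0n; apply: ge_ereal_sup => _ [m /= nm] <-.
by rewrite lee_fin h// (leq_trans n0n).
Qed.

(** If the two limits agreed, the bounded sequence would converge to a finite limit, and second
    differences at late indices would be small. *)
Lemma limn_einf_lt_esup r (lo hi eps : R) n0 : (0 < eps)%R ->
  (forall n, (n0 <= n)%N -> (lo <= r n <= hi)%R) ->
  (forall n, exists a b c, 
    [/\ (n <= a)%N, (n <= b)%N, (n <= c)%N &
      (r a - 2 * r b + r c = - eps)%R]) ->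
  limn_einf (fun n => (r n)%:E) < limn_esup (fun n => (r n)%:E).
Proof.
move=> eps0 rb osc; rewrite ltNge; apply/negP; set u := fun n => (r n)%:E => ui.
have lol : lo%:E <= limn_einf u.
  by apply: (@limn_einf_ge _ _ n0) => n /rb/andP[].
have lhi : limn_esup u <= hi%:E.
  by apply: (@limn_esup_le _ _ n0) => n /rb/andP[].
have lE : limn_esup u = limn_einf u.
  by apply/eqP; rewrite eq_le ui limn_einf_sup.
have lfin : limn_einf u \is a fin_num.
  rewrite fin_numE -ltNye -ltey (lt_le_trans _ lol) ?ltNyr//=.
  by rewrite -lE (le_lt_trans lhi) ?ltry.
have ul : u @ \oo --> limn_einf u.
  apply: (@squeeze_cvge _ _ _ _ (einfs u) _ (esups u)).
  - apply: nearW => n; apply/andP; split.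
    + by apply: ereal_inf_lbound; exists n => /=.
    + by apply: ereal_sup_ubound; exists n => /=.
  - by rewrite limn_einf_lim; exact: is_cvg_einfs.
  - by rewrite -lE limn_esup_lim; exact: is_cvg_esups.
have rl : (r @ \oo --> fine (limn_einf u))%R.
  by move: ul; rewrite -(fineK lfin) => /fine_cvg.
(* The coefficients 1, 2, 1 add up to 4, so the second difference is within [eps / 2] of 0. *)
have e40 : (0 < eps / 8)%R by rewrite divr_gt0.
have /cvgrPdist_lt/(_ _ e40) [N _ rN] := rl.
have [a [b [c [Na Nb Nc abc]]]] := osc N.
have := rN a Na; have := rN b Nb; have := rN c Nc.
rewrite /= !ltr_norml => /andP[? ?] /andP[? ?] /andP[? ?].
by lra.
Qed.

End OscillatingSequences.

Theorem corollary4p11 (R : realType) (Sigma : nat -> {fset R})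
    (hSigma : short_term_solution Sigma) :
  let ratio : nat -> \bar R :=
    fun n => (location_cost (Sigma n) / long_term_cost R n)%:E in
  (1 < limn_einf ratio)%E /\ (limn_einf ratio < limn_esup ratio)%E.
Proof.
have [f [f0 fstep costE]] := short_term_tagging hSigma.
pose r (n : nat) : R := location_cost (Sigma n) / long_term_cost R n.
have rE n : r n.+1 =
    4 * (n.+1%:R * \sum_(u <- f n) pcost (piece_of u)).
  by rewrite /r costE long_term_costE// invrK mulrC mulrA.
have r_ge n : (6 <= n)%N -> 1 + 1 / 450 <= r n.
  by case: n => // n n5; rewrite rE mulrA; exact: cost_ratio_gt1.
have r_le n : (6 <= n)%N -> r n <= 32.
  by case: n => // n _; rewrite rE; have := cost_bounded f0 fstep n; lra.
split; rewrite -/(r _).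
  apply: lt_le_trans (limn_einf_ge r_ge).
  by rewrite lte_fin; lra.
(* 32 is four times the bound of [cost_bounded], and 1/9 four times the 1/36 of
   [cost_oscillation]. *)
apply: (@limn_einf_lt_esup _ r (1 + 1 / 450) 32 (1 / 9) 6); first by lra.
  by move=> n n6; rewrite r_ge// r_le.
move=> n; have [a [b [c [na nb nc abc]]]] := cost_oscillation f0 fstep n.
exists a.+1, b.+1, c.+1; split; [exact: leqW|exact: leqW|exact: leqW|].
by rewrite !rE; lra.
Qed.
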